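(* There is a separable locally compact Hausdorff space $K$ of weight continuum such that for every $\varepsilon>0$ and every subset $\mathcal{Y}$ of the unit sphere of $C_0(K)$ whose cardinality is a regular uncountable cardinal, there is a subset $\mathcal{Z}\subseteq\mathcal{Y}$ of the same cardinality as $\mathcal{Y}$ which is $(1+\varepsilon)$-concentrated.
   Context: $C_0(K)$ is the real Banach space of continuous functions $f:K\to\mathbb{R}$ such that for each $\varepsilon>0$ there is a compact $L\subseteq K$ with $|f(x)|<\varepsilon$ for all $x\in K\setminus L$, with the supremum norm $\|\cdot\|_\infty$. For $r>0$, a subset $\mathcal{Z}$ of a Banach space is $r$-concentrated if $\|y-y'\|\le r$ for any two distinct $y,y'\in\mathcal{Z}$. *)

(* Defs.v *)
From HB Require Import structures.
From mathcomp Require Import all_boot all_order all_algebra.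
From mathcomp Require Import ring.
From mathcomp Require Import all_classical all_reals all_analysis.

Set Implicit Arguments.
Unset Strict Implicit.
Unset Printing Implicit Defensive.

Import Order.TTheory GRing.Theory Num.Theory.
Import numFieldNormedType.Exports.

Local Open Scope classical_set_scope.
Local Open Scope ring_scope.
Local Open Scope card_scope.

Definition card_lt T U (A : set T) (B : set U) : bool :=
  (A #<= B) && ~~ (B #<= A).

(* [#|A|] is an infinite cardinal that is not the union of fewer than [#|A|]
   sets, each of cardinality less than [#|A|]. *)
Definition regular_cardinality T (A : set T) : Prop :=
  infinite_set A /\
  forall F : set (set T), card_lt F A -> (forall B, F B -> card_lt B A) ->
    A <> \bigcup_(B in F) B.

Definition separable (T : topologicalType) : Prop :=
  exists2 D : set T, countable D & dense D.

(* The least cardinality of a base of [T] is [#|A|]. *)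
Definition has_weight (T : topologicalType) U (A : set U) : Prop :=
  (exists2 B : set (set T), basis B & B #= A) /\
  forall B : set (set T), basis B -> A #<= B.

Definition concentrated (R : numFieldType) (V : normedModType R)
    (r : R) (Z : set V) : Prop :=
  forall y y', Z y -> Z y' -> y <> y' -> `|y - y'| <= r.

Definition unit_sphere (R : numFieldType) (V : normedModType R) : set V :=
  [set v | `|v| = 1].
Arguments unit_sphere {R} V.

Section C0_space.
Context (K : topologicalType) (R : realType).
Implicit Types f g : K -> R.

Definition vanishes_at_infinity f : Prop :=
  forall e : R, 0 < e ->
    exists2 L : set K, compact L & forall x, ~ L x -> `|f x| < e.

Definition C0_pred : {pred K -> R} :=
  mem [set f | continuous f /\ vanishes_at_infinity f].

Record C0 := mkC0 { C0_fun :> K -> R ; _ : C0_fun \in C0_pred }.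

HB.instance Definition _ := [isSub for C0_fun].
HB.instance Definition _ := [Choice of C0 by <:].

Lemma C0_predP f : f \in C0_pred <-> continuous f /\ vanishes_at_infinity f.
Proof. by rewrite /C0_pred inE. Qed.

Lemma C0_submod_closed : submod_closed C0_pred.
Proof.
split=> [|a f g /C0_predP[cf vf] /C0_predP[cg vg]]; apply/C0_predP; split.
- by move=> x; exact: cvg_cst.
- move=> e e0; exists set0; first exact: compact0.
  by move=> x _; rewrite normr0.
- move=> x; apply: (@cvgD _ R^o); last exact: cg.
  by apply: (@cvgZl_tmp _ R^o); exact: cf.
- move=> e e0; have a0 : 0 < 2 * (`|a| + 1) by rewrite mulr_gt0 // ltr_wpDl.
  have [L cL fL] := vf _ (divr_gt0 e0 a0).
  have [M cM gM] := vg _ (divr_gt0 e0 (ltr0n R 2)).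
  exists (L `|` M) => [|x /not_orP[Lx Mx]]; first exact: compactU.
  rewrite (splitr e) (le_lt_trans (ler_normD _ _))// ltr_leD//; last first.
    exact/ltW/gM.
  rewrite normrZ (le_lt_trans (y := `|a| * (e / (2 * (`|a| + 1)))))//.
    by rewrite ler_wpM2l// ltW// fL.
  rewrite mulrCA ltr_pM2l// invfM mulrCA gtr_pMr// ltr_pdivrMr//.
  by rewrite mul1r ltrDl.
Qed.

HB.instance Definition _ :=
  GRing.isSubmodClosed.Build R (K -> R) C0_pred C0_submod_closed.
HB.instance Definition _ := [SubChoice_isSubLmodule of C0 by <:].

Implicit Types u v : C0.

Lemma C0P u : continuous u /\ vanishes_at_infinity u.
Proof. by apply/C0_predP; case: u. Qed.

Lemma C0_eqP u v : u =1 v -> u = v.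
Proof. by move=> uv; apply/val_inj/funext. Qed.

Definition C0_norm u : R := sup [set `|u x| | x in [set: K]].

Lemma C0_has_ubound u : has_ubound [set `|u x| | x in [set: K]].
Proof.
have [cu vu] := C0P u; have [L cL uL] := vu 1 ltr01.
have /compact_bounded[M [_ /(_ (`|M| + 1))]] : compact (u @` L : set R^o).
  by apply: continuous_compact => //; exact: continuous_subspaceT.
rewrite (le_lt_trans (ler_norm _)) ?ltrDl// => /(_ isT) uM.
exists (`|M| + 1) => _ [x _ <-]; have [Lx|Lx] := pselect (L x).
  by apply: uM; exists x.
by rewrite (le_trans (ltW (uL _ Lx)))// lerDr.
Qed.

Lemma C0_le_norm u x : `|u x| <= C0_norm u.
Proof. by apply: ub_le_sup; [exact: C0_has_ubound|exists x]. Qed.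

Lemma C0_norm_le u (r : R) : 0 <= r -> (forall x, `|u x| <= r) ->
  C0_norm u <= r.
Proof.
move=> r0 ur; have [S0|/set0P S0] := eqVneq [set `|u x| | x in [set: K]] set0.
  by rewrite /C0_norm S0 sup0.
by apply: ge_sup => // _ [x _ <-].
Qed.

Lemma C0_norm_ge0 u : 0 <= C0_norm u.
Proof.
have [S0|/set0P[_ [x _ _]]] := eqVneq [set `|u x| | x in [set: K]] set0.
  by rewrite /C0_norm S0 sup0.
exact: le_trans (normr_ge0 _) (C0_le_norm u x).
Qed.

Let C0_normD u v : C0_norm (u + v) <= C0_norm u + C0_norm v.
Proof.
apply: C0_norm_le => [|x]; first by rewrite addr_ge0 ?C0_norm_ge0.
by rewrite (le_trans (ler_normD _ _))// lerD ?C0_le_norm.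
Qed.

Let C0_normZ (a : R) u : C0_norm (a *: u) = `|a| * C0_norm u.
Proof.
have nZ b w : C0_norm (b *: w) <= `|b| * C0_norm w.
  apply: C0_norm_le => [|x]; first by rewrite mulr_ge0 ?C0_norm_ge0.
  by rewrite [_ x]/(b * w x) normrM ler_wpM2l ?C0_le_norm.
apply/eqP; rewrite eq_le nZ/=; have [->|a0] := eqVneq a 0.
  by rewrite normr0 mul0r C0_norm_ge0.
have := nZ a^-1 (a *: u); rewrite scalerA mulVf// scale1r normfV.
by rewrite ler_pdivlMl ?normr_gt0.
Qed.

Let C0_norm0_eq0 u : C0_norm u = 0 -> u = 0.
Proof.
move=> u0; apply: C0_eqP => x; apply/eqP.
by rewrite -normr_le0 -u0 C0_le_norm.
Qed.

HB.instance Definition _ :=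
  Lmodule_isNormed.Build R C0 C0_normD C0_normZ C0_norm0_eq0.

Lemma C0_normE u : `|u| = sup [set `|u x| | x in [set: K]].
Proof. by []. Qed.

Lemma C0_complete (F : set_system C0) : ProperFilter F -> cauchy F -> cvg F.
Proof.
move=> FF /cauchyP Fc.
have Fx x : cvg ((fun u : C0 => u x : R^o) @ F).
  apply: R_complete; apply/cauchyP => e e0; have [u Fu] := Fc _ e0.
  exists (u x); change (F [set v : C0 | ball (u x : R^o) e (v x)]).
  apply: filterS Fu => v /=; rewrite -!ball_normE/=; apply: le_lt_trans.
  exact: (C0_le_norm (u - v)).
pose g x : R := lim ((fun u : C0 => u x : R^o) @ F).
have Fg (e : R) : 0 < e -> F [set u : C0 | forall x, `|g x - u x| <= e].
  move=> e0; have e20 : 0 < e / 2 by rewrite divr_gt0.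
  have [u Fu] := Fc _ e20; apply: filterS (Fu) => v uv x.
  have gu : `|g x - u x| <= e / 2.
    apply/ler_addgt0Pl => d d0.
    have /cvgrPdist_lt/(_ _ d0) gd := Fx x.
    have [w [gw uw]] := filter_ex (filterI gd Fu).
    rewrite -(subrKA (w x)) (le_trans (ler_normD _ _))// lerD ?(ltW gw)//.
    move: uw; rewrite -ball_normE/= distrC => /ltW; apply: le_trans.
    by rewrite distrC -[u - w]opprB normrN; exact: (C0_le_norm (w - u)).
  rewrite (splitr e) -(subrKA (u x)) (le_trans (ler_normD _ _))// lerD//.
  move: uv; rewrite -ball_normE/= => /ltW; apply: le_trans.
  exact: (C0_le_norm (u - v)).
have gc0 : g \in C0_pred.
  apply/C0_predP; split => [x|e e0].
    apply/(@cvgrPdist_lt _ R^o) => e e0.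
    have e30 : 0 < e / 3 by rewrite divr_gt0.
    have [u gu] := filter_ex (Fg _ e30).
    have /(@cvgrPdist_lt _ R^o)/(_ _ e30) := (C0P u).1 x.
    apply: filterS => y uxy.
    have -> : g x - g y = (g x - u x) + (u x - u y) - (g y - u y) by ring.
    have -> : e = e / 3 + e / 3 + e / 3 by field.
    rewrite (le_lt_trans (ler_normB _ _))// ltr_leD//.
    by rewrite (le_lt_trans (ler_normD _ _))// ler_ltD.
  have e20 : 0 < e / 2 by rewrite divr_gt0.
  have [u gu] := filter_ex (Fg _ e20).
  have [L cL uL] := (C0P u).2 _ e20; exists L => // x Lx.
  rewrite (splitr e) -(subrK (u x) (g x)) (le_lt_trans (ler_normD _ _))//.
  by rewrite ler_ltD// uL.
apply/cvg_ex; exists (mkC0 gc0); apply/cvgrPdist_le => e e0.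
apply: filterS (Fg _ e0) => u gu.
by apply: C0_norm_le => //; exact: ltW.
Qed.

HB.instance Definition _ := Uniform_isComplete.Build C0 C0_complete.
End C0_space.

Arguments C0 : clear implicits.

(* Main.v *)
Require Import Defs.
From HB Require Import structures.
From mathcomp Require Import all_boot all_order all_algebra.
From mathcomp Require finmap.
From mathcomp Require Import lra.
From mathcomp Require Import all_classical all_reals all_analysis.
Import Order.TTheory GRing.Theory Num.Theory.
Import numFieldNormedType.Exports.

Local Open Scope classical_set_scope.
Local Open Scope ring_scope.
Local Open Scope card_scope.

(* Take for [K] the Mrowka-Isbell space of an almost disjoint family of branches
   of the binary tree: the nodes are isolated, and each real [x] is a point
   whose neighbourhoods contain almost all nodes of the branch [cut x].  Up to a
   small error, a function vanishing at infinity is given by finitely many data: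
   a level [m], its values at the nodes up to level [m], and, for each node [s]
   of level [m], a number [q s] such that above [s] it equals [q s] on a single
   branch and 0 elsewhere.  Rounding makes these data countable, so a set of
   regular uncountable cardinality contains a subset of the same cardinality on
   which they are constant.  Two norm one functions with the same data differ
   above [s] by 0, [q s] or [- q s], up to a small error, and [`|q s| <= 1]. *)

(** * Cardinality and rounding *)

Lemma near_infty_all {T : eqType} (s : seq T) (P : T -> nat -> Prop) :
  (forall x, x \in s -> \forall n \near \oo, P x n) ->
  \forall n \near \oo, forall x, x \in s -> P x n.
Proof.
elim: s => [_|a s IH sP]; first exact: filterE.
have Ps : \forall n \near \oo, forall x, x \in s -> P x n.
  by apply: IH => x xs; apply: sP; rewrite inE xs orbT.
apply: filterS2 (sP a (mem_head a s)) Ps => n Pa Ps' x.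
by rewrite inE => /predU1P[->//|/Ps'].
Qed.

Lemma card_le_inj {T U} {A : set T} {B : set U} (f : T -> U) :
  {in A &, injective f} -> f @` A `<=` B -> A #<= B.
Proof.
move=> finj fAB; apply: card_le_trans (subset_card_le fAB).
by have := inj_card_eq finj; rewrite card_eq_le => /andP[].
Qed.

(** Otherwise [A] would be a union of countably many, hence fewer than [A], smaller fibres, against
    regularity. *)
Lemma regular_fiber {T} {I : countType} {A : set T} (f : T -> I) :
  regular_cardinality A -> ~ countable A ->
  exists i, A `&` f @^-1` [set i] #= A.
Proof.
move=> [Ainf Areg] Aunc; apply: contrapT => /forallNP nofiber.
apply: (Areg (range (fun i => A `&` f @^-1` [set i]))).
- have cF : countable (range (fun i => A `&` f @^-1` [set i])).
    exact: card_le_trans (card_image_le _ _) (countableP _).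
  apply/andP; split; first by apply: card_le_trans cF _; exact/infiniteP.
  by apply/negP => AF; apply: Aunc; exact: sub_countable AF cF.
- move=> _ [i _ <-]; have sA : A `&` f @^-1` [set i] #<= A.
    by apply: subset_card_le => x [].
  rewrite /card_lt sA /=; apply/negP => As; apply: (nofiber i).
  by rewrite card_eq_le sA As.
- apply/seteqP; split=> [x Ax|x [_ [i _ <-] []]//].
  by exists (A `&` f @^-1` [set f x]) => //; exists (f x).
Qed.

Lemma card_le_prod_countable (R : realType) (I : countType) :
  [set: R * I] #<= [set: R].
Proof.
(* [x / (1 + `|x|)] lies in ]-1, 1[, so adding multiples of 3 keeps the
   indices apart. *)
pose g (p : R * I) : R := p.1 / (1 + `|p.1|) + 3 * (pickle p.2)%:R.
apply: (card_le_inj g) => // -[x i] [y j] _ _; rewrite /g/=.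
have sq (t : R) : -1 < t / (1 + `|t|) < 1.
  have t1 : 0 < 1 + `|t| by rewrite ltr_pwDl.
  by rewrite ltr_pdivlMr// ltr_pdivrMr// mul1r mulN1r -ltr_norml ltrDr.
have /andP[x1 x2] := sq x; have /andP[y1 y2] := sq y; move=> E.
have ij : i = j.
  apply: (pcan_inj pickleK); apply/eqP; rewrite eqn_leq.
  suff H k l : (k < l)%N -> k.+1%:R <= l%:R :> R.
    by apply/andP; split; rewrite leqNgt; apply/negP => /H; rewrite -natr1; lra.
  by rewrite ler_nat.
rewrite -ij in E *; move/addIr: E => E; congr pair.
have x0 : 1 + `|x| != 0 by rewrite gt_eqF// ltr_pwDl.
have y0 : 1 + `|y| != 0 by rewrite gt_eqF// ltr_pwDl.
have {}E : x * (1 + `|y|) = y * (1 + `|x|).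
  by apply/eqP; rewrite -eqr_div//; apply/eqP.
(* For equal signs the product terms cancel; for opposite signs the two sides cannot agree. *)
by move: E; case: (ger0P x) => ?; case: (ger0P y) => ?; nra.
Qed.

Lemma floor_eq_dist (R : realType) (a b e : R) : 0 < e ->
  Num.floor (a / e) = Num.floor (b / e) -> `|a - b| <= e.
Proof.
move=> e0 ab; have /andP[a1 a2] := floor_itv (a / e).
have /andP[b1 b2] := floor_itv (b / e).
rewrite -ab in b1 b2; rewrite intrD mulr1z in a2 b2.
rewrite -[a](divfK (lt0r_neq0 e0)) -[b](divfK (lt0r_neq0 e0)) -mulrBl.
by rewrite normrM (gtr0_norm e0) ger_pMl// ler_norml; lra.
Qed.

(** * Almost disjoint branches of the binary tree *)

Section tree_space.
Context {R : realType}.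
Implicit Types (x y : R) (s : seq bool) (m n : nat).

(* The first [n] bits of the Dedekind cut of [x], along the enumeration of the
   rationals given by [unpickle] (padded with 0 at unused codes). *)
Definition cut x : nat -> seq bool :=
  mkseq (fun i => ratr (odflt 0 (unpickle i)) < x).

Lemma size_cut x n : size (cut x n) = n.
Proof. exact: size_mkseq. Qed.

Lemma take_cut x m n : (m <= n)%N -> take m (cut x n) = cut x m.
Proof.
by move=> mn; rewrite /cut /mkseq -map_take take_iota (minn_idPl mn).
Qed.

(** A rational between [x] and [y] is a bit where the cuts differ, and every longer prefix keeps
    it. *)
Lemma cut_neq x y : x != y -> \forall n \near \oo, cut x n != cut y n.
Proof.
wlog xy : x y / x < y.
  move=> H; rewrite neq_lt => /orP[xy|yx]; first by apply: H; rewrite ?lt_eqF.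
  have := H y x yx; rewrite lt_eqF// => /(_ isT).
  by apply: filterS => n; rewrite eq_sym.
move=> _; have [q] := rat_in_itvoo xy; rewrite in_itv/= => /andP[xq qy].
near=> n; apply/eqP => /(congr1 (nth false ^~ (pickle q))).
have qn : (pickle q < n)%N by near: n; exact: nbhs_infty_gt.
by rewrite !nth_mkseq// pickleK/= qy ltNge (ltW xq).
Unshelve. all: by end_near. Qed.

End tree_space.

(* [inl s] is a node of the binary tree, [inr x] the end of the branch
   [cut x]. *)
Definition tree_space (R : realType) : Type := (seq bool + R)%type.

HB.instance Definition _ (R : realType) := Choice.on (tree_space R).
HB.instance Definition _ (R : realType) :=
  isPointed.Build (tree_space R) (inl [::]).

(** * The topology of the tree space *)

Section topology.
Context {R : realType}.
Local Notation K := (tree_space R).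
Implicit Types (x y : R) (s : seq bool) (m n : nat) (z : K) (A : set K).

Definition tree_open A := forall x, A (inr x) ->
  \forall n \near \oo, A (inl (cut x n)).

Let tree_openT : tree_open setT.
Proof. by move=> x _; near=> n. Unshelve. all: by end_near. Qed.

Let tree_openI : setI_closed tree_open.
Proof.
move=> A B oA oB x [Ax Bx].
by apply: filterS2 (oA x Ax) (oB x Bx) => n; split.
Qed.

Let tree_open_bigU (I : Type) (f : I -> set K) :
  (forall i, tree_open (f i)) -> tree_open (\bigcup_i f i).
Proof.
by move=> of_ x [i _ fix_]; apply: filterS (of_ i x fix_) => n; exists i.
Qed.

HB.instance Definition _ :=
  isOpenTopological.Build K tree_openT tree_openI tree_open_bigU.

Lemma open_treeE A : open A = tree_open A.
Proof. by []. Qed.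

Lemma open_node s : open [set (inl s : K)].
Proof. by rewrite open_treeE => x. Qed.

(** As [m] varies, these compact open sets form a neighbourhood base at [inr x]. *)
Definition branch x m : set K := [set z | match z with
  | inl s => (m <= size s)%N /\ s = cut x (size s)
  | inr y => y = x
  end].

Lemma open_branch x m : open (branch x m).
Proof.
rewrite open_treeE => y ->; near=> n; rewrite /branch/= size_cut; split=> //.
by near: n; exact: nbhs_infty_ge.
Unshelve. all: by end_near. Qed.

Lemma nbhs_cut x A : nbhs (inr x : K) A ->
  \forall n \near \oo, A (inl (cut x n)).
Proof.
by rewrite nbhsE => -[B [oB Bx] BA]; apply: filterS (oB x Bx) => n /BA.
Qed.

Lemma tree_basis_sub A z : open A -> A z ->
  if z is inr x then exists m, branch x m `<=` A else [set z] `<=` A.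
Proof.
case: z => [s _ As _ ->//|x oA Ax].
have [m _ mA] := oA x Ax; exists m => -[s [ms ->]|y ->//]; exact: mA.
Qed.

Lemma tree_hausdorff : hausdorff_space K.
Proof.
(* A single node is clopen: a branch has only one node of each length, so its longer nodes avoid
   [s]. *)
have node s z : inl s != z -> exists2 AB : set K * set K,
    inl s \in AB.1 /\ z \in AB.2 &
    [/\ open AB.1, open AB.2 & AB.1 `&` AB.2 == set0].
  move=> sz; exists ([set inl s], ~` [set inl s]) => /=.
    by rewrite !inE/=; split=> // /esym/eqP; exact/negP.
  split; [exact: open_node| |by rewrite setICr].
  rewrite open_treeE => x _; near=> n => -[sn].
  suff : (size s < n)%N by rewrite -sn size_cut ltnn.
  by near: n; exact: nbhs_infty_gt.
rewrite open_hausdorff => -[s z|x [s|y]]; first exact: node.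
  rewrite eq_sym => /node[[A B]/= [sA xB] [oA oB AB]].
  by exists (B, A) => /=; rewrite // setIC.
move=> xy; have {}xy : x != y by apply: contra_neq xy => ->.
have [m _ mxy] := cut_neq _ _ xy.
exists (branch x m, branch y m) => /=; first by rewrite !inE.
split; [exact: open_branch|exact: open_branch|apply/eqP; rewrite -subset0].
move=> [s [[ms sx] [_ sy]]|z [-> yx]]; last by move: xy; rewrite yx eqxx.
by have := mxy _ ms; rewrite -sx -sy eqxx.
Unshelve. all: by end_near. Qed.

(** If [F] does not cluster at the end [inr x], some member of [F] misses a neighbourhood of it,
    hence almost all of the branch, so [F] contains a finite set. *)
Lemma compact_branch x m : compact (branch x m).
Proof.
move=> F FF Fb; have [cx|] := pselect (cluster F (inr x)).
  by exists (inr x); split.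
move=> /existsNP[A /existsNP[B /not_implyP[FA /not_implyP[Bx AB0]]]].
have [k _ kB] := nbhs_cut _ _ Bx.
have AB z : A z -> ~ B z by move=> Az Bz; apply: AB0; exists z.
pose S := branch x m `&` [set (inl (cut x n) : K) | n in `I_k].
have FS : F S.
  apply: filterS2 Fb FA => -[s [ms sE] As|_ -> /AB[]]; last first.
    exact: nbhs_singleton Bx.
  split=> //; exists (size s); last by rewrite -sE.
  rewrite /= ltnNge; apply/negP => ks; apply: (AB _ As).
  by rewrite sE; exact: kB.
have fS : finite_set S
  by apply: finite_setIr; exact: finite_image (finite_II k).
by have [z [[bz _] zF]] := finite_compact fS FF FS; exists z.
Qed.

Lemma tree_locally_compact : locally_compact [set: K].
Proof.
move=> z _; pose U := if z is inr x then branch x 0 else [set z].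
have [oU cU Uz] : [/\ open U, compact U & U z].
  rewrite /U; case: z {U} => [s|x]; split=> //=.
  - exact: compact_set1.
  - exact: open_branch.
  - exact: compact_branch.
exists U; last by split=> //; exact: compact_closed tree_hausdorff cU.
by rewrite /within/=; apply: filterS (open_nbhs_nbhs (conj oU Uz)).
Qed.

(** A finite subcover by branches and single nodes gives [xs] as the ends of its branches; [n]
    exceeds the lengths of its single nodes. *)
Lemma compact_tree (L : set K) : compact L -> exists xs : seq R,
  (forall x, L (inr x) -> x \in xs) /\
  \forall n \near \oo, forall s, (n <= size s)%N -> L (inl s) ->
    exists2 x, x \in xs & s = cut x (size s).
Proof.
pose f z := if z is inr x then branch x 0 else [set z].
rewrite compact_cover => /(_ _ setT f)[z _| z _|D _ LD].
- by case: z => [s|x]; [exact: open_node|exact: open_branch].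
- by exists z => //; case: z.
pose xs := pmap (fun z : K => if z is inr x then Some x else None)
  (finmap.enum_fset D).
have inxs x : (inr x : K) \in finmap.enum_fset D -> x \in xs.
  by move=> xD; rewrite mem_pmap; apply/mapP; exists (inr x).
exists xs; split=> [x /LD[[s|y]/= yD]//|]; first by move=> ->; exact: inxs.
have : \forall n \near \oo, forall z, z \in finmap.enum_fset D ->
    if z is inl s then (size s < n)%N else true.
  apply: near_infty_all => -[s|x] _; last exact: filterE.
  exact: nbhs_infty_gt.
apply: filterS => n Dn s ns /LD[[t|x]/= tD].
  by move=> [st]; have := Dn _ tD; rewrite /= -st ltnNge ns.
by move=> [_ sx]; exists x => //; exact: inxs.
Qed.

(** * Separability and weight *)

Lemma tree_separable : separable K.
Proof.
exists (range (inl : seq bool -> K)).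
  exact: card_le_trans (card_image_le _ _) (countableP _).
move=> A [[s|x] Ax] oA; first by exists (inl s); split=> //; exists s.
have [m _ mA] := oA x Ax; exists (inl (cut x m)).
by split; [exact: mA (leqnn m)|exists (cut x m)].
Qed.

Lemma tree_weight : has_weight K [set: R].
Proof.
(* A basic set between [inr x] and [branch x 0] contains no other end, so it determines [x]. *)
have leB (B : set (set K)) : basis B -> [set: R] #<= B.
  move=> [oB bB].
  have /choice[g gP] x : exists U : set K,
      [/\ B U, U (inr x) & U `<=` branch x 0].
    have [|U [BU Ux] Ub] := bB (inr x) (branch x 0); last by exists U.
    by apply: open_nbhs_nbhs; split=> //; exact: open_branch.
  apply: (card_le_inj g) => [x y _ _ gxy|_ [x _ <-]]; last by have [] := gP x.
  have [_ _ gy] := gP y; have [_ gx _] := gP x.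
  by have := gx; rewrite gxy => /gy.
split=> //; pose h (p : R * (seq bool + nat)) : set K :=
  match p.2 with inl s => [set inl s] | inr m => branch p.1 m end.
have bh : basis (range h).
  split=> [_ [[x [s|m]] _ <-]|z A].
  - exact: open_node.
  - exact: open_branch.
  rewrite nbhsE => -[B [oB Bz] BA]; have := tree_basis_sub _ _ oB Bz.
  case: z Bz => [s _ sB|x _ [m mB]].
    exists [set inl s]; last exact: subset_trans sB BA.
    by split=> //; exists (0, inl s).
  exists (branch x m); last exact: subset_trans mB BA.
  by split=> //; exists (x, inr m).
exists (range h) => //; rewrite card_eq_le leB// andbT.
exact: card_le_trans (card_image_le _ _) (card_le_prod_countable _ _).
Qed.

(* Up to [e], above level [m] the function [u] is zero off finitely many
   branches; they lie in distinct cones over nodes of level [m], and [q] lists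
   their limits. *)
Lemma C0_tree_approx (u : C0 K R) (e : R) : 0 < e ->
  exists m (q : seq bool -> R),
    [/\ forall s, `|q s| <= `|u|,
        forall s, (m <= size s)%N ->
          `|u (inl s)| < e \/ `|u (inl s) - q (take m s)| < e &
        forall x, `|u (inr x)| < e \/ `|u (inr x) - q (cut x m)| < e].
Proof.
move=> e0; have [uc /(_ e e0)[L cL uL]] := C0P u.
have [xs [Lxs Lm]] := compact_tree _ cL.
have sep : \forall n \near \oo, forall x, x \in xs -> forall y, y \in xs ->
    cut x n = cut y n -> x = y.
  apply: near_infty_all => x _; apply: near_infty_all => y _.
  have [->|xy] := eqVneq x y; first exact: filterE.
  by apply: filterS (cut_neq x y xy) => n /eqP.
have ulim : \forall n \near \oo, forall x, x \in xs -> forall k, (n <= k)%N ->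
    `|u (inl (cut x k)) - u (inr x)| < e.
  apply: near_infty_all => x _.
  have /(@cvgrPdist_lt _ R^o)/(_ _ e0)/nbhs_cut[N _ Nu] := uc (inr x).
  exists N => // n /= Nn k nk; rewrite distrC; apply: Nu.
  exact: leq_trans Nn nk.
have [m [Lm_ [sepm ulimm]]] := filter_ex (filterI Lm (filterI sep ulim)).
(* By the choice of [m], at most one real of [xs] has its branch through a given [s] of length [m];
   0 is the value when there is none. *)
pose q s := if [seq x <- xs | cut x m == s] is x :: _ then u (inr x) else 0.
have qE x : x \in xs -> q (cut x m) = u (inr x).
  move=> xxs; rewrite /q; case E : [seq _ <- _ | _] => [|y ys].
    have : x \in [seq y <- xs | cut y m == cut x m] by rewrite mem_filter eqxx.
    by rewrite E.
  have : y \in [seq y <- xs | cut y m == cut x m] by rewrite E mem_head.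
  by rewrite mem_filter => /andP[/eqP yx yxs]; rewrite (sepm _ yxs _ xxs yx).
exists m, q; split.
- move=> s; rewrite /q; case: [seq _ <- _ | _] => [|x _].
    by rewrite normr0 normr_ge0.
  exact: C0_le_norm.
- move=> s ms; have [Ls|/uL] := pselect (L (inl s)); last by left.
  have [x xxs ->] := Lm_ s ms Ls; right.
  by rewrite take_cut// qE//; exact: ulimm.
- move=> x; have [/Lxs xxs|/uL] := pselect (L (inr x)); last by left.
  by right; rewrite qE// subrr normr0.
Qed.

Lemma C0_tree_concentrated (e : R) (Y : set (C0 K R)) :
  0 < e -> Y `<=` unit_sphere (C0 K R) ->
  regular_cardinality Y -> ~ countable Y ->
  exists Z : set (C0 K R), [/\ Z `<=` Y, Z #= Y & concentrated (1 + e) Z].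
Proof.
move=> e0 Y1 Yreg Yunc; pose d := e / 3.
have d0 : 0 < d by rewrite divr_gt0.
have de : e = 3 * d by rewrite mulrC divfK// pnatr_eq0.
have /choice[p pP] (u : C0 K R) : exists p : nat * (seq bool -> R),
    [/\ forall s, `|p.2 s| <= `|u|,
        forall s, (p.1 <= size s)%N ->
          `|u (inl s)| < d \/ `|u (inl s) - p.2 (take p.1 s)| < d &
        forall x, `|u (inr x)| < d \/ `|u (inr x) - p.2 (cut x p.1)| < d].
  by have [m [q mq]] := C0_tree_approx u d d0; exists (m, q).
(* [bseq] ranges over the finitely many nodes up to the level; rounding to multiples of [d] makes
   the codes countable. *)
pose code u : nat * seq (int * int) :=
  ((p u).1, [seq (Num.floor (u (inl (bseqval t)) / d),
                  Num.floor ((p u).2 (bseqval t) / d))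
            | t <- enum {: {bseq (p u).1 of bool}}]).
have [i Yi] := regular_fiber code Yreg Yunc.
exists (Y `&` code @^-1` [set i]); split=> //.
move=> u v [Yu <-] [Yv /esym]; rewrite /code => -[].
have := Y1 _ Yu; have := Y1 _ Yv; rewrite /unit_sphere/= => v1 u1.
have [] := pP u; have [] := pP v; rewrite u1 v1.
case: (p u) => m q; case: (p v) => m' q' /= q'1 vs vx q1 us ux mm'.
case: _ / mm' in q' q'1 vs vx * => /eq_in_map uv _.
have {}uv s : (size s <= m)%N ->
    `|u (inl s) - v (inl s)| <= d /\ `|q s - q' s| <= d.
  move=> sm; have /= [] := uv (Bseq sm) (mem_enum _ _).
  by split; exact: floor_eq_dist.
(* The difference is below [2 * d] if both values are near 0, below [1 + 2 * d] if one is, and below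
   [3 * d], which is [e], if they are near [c] and [c']. *)
have split_le (a b c c' : R) : `|a| < d \/ `|a - c| < d ->
    `|b| < d \/ `|b - c'| < d -> `|c| <= 1 -> `|c'| <= 1 -> `|c - c'| <= d ->
    `|a - b| <= 1 + e.
  rewrite !ltr_norml !ler_norml de => -[]/andP[? ?] []/andP[? ?];
  by move=> /andP[? ?] /andP[? ?] /andP[? ?]; lra.
apply: C0_norm_le => [|[s|x]]; first by rewrite addr_ge0// ltW.
- have [ms|sm] := leqP m (size s); last first.
    by apply: le_trans (uv s (ltnW sm)).1 _; rewrite de; lra.
  apply: split_le (us s ms) (vs s ms) (q1 _) (q'1 _) (uv _ _).2.
  by rewrite size_take_min geq_minl.
- apply: split_le (ux x) (vx x) (q1 _) (q'1 _) (uv _ _).2.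
  by rewrite size_cut.
Qed.

End topology.

Theorem theorem4 (R : realType) :
  exists K : topologicalType,
    [/\ separable K, locally_compact [set: K], hausdorff_space K,
        has_weight K [set: R] &
        forall (e : R) (Y : set (C0 K R)),
          0 < e ->
          Y `<=` unit_sphere (C0 K R) ->
          regular_cardinality Y -> ~ countable Y ->
          exists Z : set (C0 K R),
            [/\ Z `<=` Y, Z #= Y & concentrated (1 + e) Z]].
Proof.
exists (tree_space R); split.
- exact: tree_separable.
- exact: tree_locally_compact.
- exact: tree_hausdorff.
- exact: tree_weight.
- exact: C0_tree_concentrated.
Qed.
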